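(* Let $G$ be an abelian group and $\phi\in\mathrm{End}(G)$. Then $\mathfrak Q(G,\phi)=\mathrm{Pol}(G,\phi)=\mathbf P(G,\phi)$.
   Context: $\mathbb N=\{0,1,2,\dots\}$, $\mathbb N_+=\{1,2,\dots\}$. A subgroup $H$ of $G$ is $\phi$-invariant if $\phi(H)\subseteq H$. For a non-empty finite subset $F$ of $G$ and $n\in\mathbb N_+$ put $T_n(\phi,F)=F+\phi(F)+\dots+\phi^{n-1}(F)$ and $\tau_{\phi,F}(n)=|T_n(\phi,F)|$. The limit $H(\phi,F)=\lim_{n\to\infty}\frac{\log\tau_{\phi,F}(n)}{n}$ exists, and the algebraic entropy of $\phi$ is $h(\phi)=\sup_F H(\phi,F)$, where $F$ ranges over all non-empty finite subsets of $G$. The Pinsker subgroup $\mathbf P(G,\phi)$ is the greatest $\phi$-invariant subgroup of $G$ such that $h(\phi\restriction_{\mathbf P(G,\phi)})=0$ (it exists). $\phi$ has polynomial growth with respect to $F$ if there is $P_F(x)\in\mathbb Z[x]$ with $\tau_{\phi,F}(n)\le P_F(n)$ for every $n\in\mathbb N_+$; $\phi$ has polynomial growth if this holds for every non-empty finite subset $F$ of $G$. $\mathrm{Pol}(G,\phi)$ is the greatest $\phi$-invariant subgroup of $G$ such that the restriction of $\phi$ to it has polynomial growth (it exists). Define $Q_0(G,\phi)=0$ and, for $n\in\mathbb N$, $Q_{n+1}(G,\phi)=\{x\in G:\ \exists\, k>m \text{ in }\mathbb N,\ (\phi^k-\phi^m)(x)\in Q_n(G,\phi)\}$. These form an increasing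 chain of $\phi$-invariant subgroups, and $\mathfrak Q(G,\phi)=\bigcup_{n\in\mathbb N}Q_n(G,\phi)$. *)

(* Defs.v *)
From HB Require Import structures.
From mathcomp Require Import all_boot all_order all_algebra finmap.
From mathcomp Require Import all_classical all_reals all_analysis.
Import Order.TTheory GRing.Theory Num.Theory.
Import numFieldNormedType.Exports.

Set Implicit Arguments.
Unset Strict Implicit.
Unset Printing Implicit Defensive.

Local Open Scope classical_set_scope.
Local Open Scope ring_scope.

Section Trajectories.
Variables (G : zmodType) (phi : {additive G -> G}).

Definition minkowski (A B : {fset G}) : {fset G} :=
  [fset (x + y)%R | x in A, y in B]%fset.

Definition trajectory (F : {fset G}) (n : nat) : {fset G} :=
  \big[minkowski/[fset 0%R]%fset]_(i < n) [fset iter i phi x | x in F]%fset.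

Definition tau (F : {fset G}) (n : nat) : nat := #|` trajectory F n|.

Definition poly_growth_wrt (F : {fset G}) : Prop :=
  exists P : {poly int},
    forall n : nat, (0 < n)%N -> (tau F n)%:Z <= P.[n%:Z].

Definition poly_growth : Prop :=
  forall F : {fset G}, F != fset0 -> poly_growth_wrt F.

(* The sequence is bounded and converges for every non-empty F, as tau is
   submultiplicative; its (meaningless) term at n = 0 does not matter. *)
Definition entropy_wrt (R : realType) (F : {fset G}) : R :=
  limn (fun n : nat => ln (tau F n)%:R / n%:R : R).

Definition entropy (R : realType) : \bar R :=
  ereal_sup [set (entropy_wrt R F)%:E | F in [set F : {fset G} | F != fset0]].

Fixpoint Qn (n : nat) : set G :=
  if n is n'.+1 then
    [set x | exists k m : nat, (m < k)%N /\ Qn n' (iter k phi x - iter m phi x)]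
  else [set 0].

Definition frakQ : set G := \bigcup_n Qn n.

End Trajectories.

Section InvariantSubgroups.
Variables (G : zmodType) (phi : {additive G -> G}).

Record inv_subgroup := InvSubgroup {
  inv_carrier :> set G;
  inv_carrier0 : inv_carrier 0;
  inv_carrierB : forall x y, inv_carrier x -> inv_carrier y ->
    inv_carrier (x - y);
  inv_carrier_phi : forall x, inv_carrier x -> inv_carrier (phi x)
}.

Definition inv_pred (H : inv_subgroup) : pred G :=
  fun x => x \in inv_carrier H.

Lemma inv_pred_zmod_closed (H : inv_subgroup) : zmod_closed (inv_pred H).
Proof.
split=> [|x y]; rewrite !unfold_in /inv_pred.
  by rewrite in_setE; exact: inv_carrier0.
by rewrite !in_setE; exact: inv_carrierB.
Qed.

HB.instance Definition _ (H : inv_subgroup) :=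
  GRing.isZmodClosed.Build G (inv_pred H) (inv_pred_zmod_closed H).

(* H regarded as an abelian group in its own right. *)
Definition inv_type (H : inv_subgroup) := {x : G | inv_pred H x}.

HB.instance Definition _ (H : inv_subgroup) := SubChoice.on (inv_type H).
HB.instance Definition _ (H : inv_subgroup) :=
  [SubChoice_isSubZmodule of inv_type H by <:].

Lemma inv_pred_phi (H : inv_subgroup) (x : inv_type H) :
  inv_pred H (phi (val x)).
Proof.
case: x => x /=; rewrite /inv_pred !in_setE; exact: inv_carrier_phi.
Qed.

Definition restr (H : inv_subgroup) (x : inv_type H) : inv_type H :=
  exist _ (phi (val x)) (inv_pred_phi x).

Lemma restr_is_zmod_morphism (H : inv_subgroup) : zmod_morphism (@restr H).
Proof. by move=> x y; apply: val_inj; rewrite /= !raddfB. Qed.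

HB.instance Definition _ (H : inv_subgroup) :=
  GRing.isZmodMorphism.Build (inv_type H) (inv_type H) (@restr H)
    (@restr_is_zmod_morphism H).

(* "A is the greatest invariant subgroup satisfying P" includes existence; by
   [greatest_inv_subgroup_unique] it determines A, so it is the way to say that
   A equals that subgroup. *)
Definition greatest_inv_subgroup (P : inv_subgroup -> Prop) (A : set G) : Prop :=
  exists H : inv_subgroup,
    [/\ inv_carrier H = A, P H
      & forall K : inv_subgroup, P K -> inv_carrier K `<=` A].

Lemma greatest_inv_subgroup_unique (P : inv_subgroup -> Prop) (A B : set G) :
  greatest_inv_subgroup P A -> greatest_inv_subgroup P B -> A = B.
Proof.
move=> [H [HA PH maxA]] [K [KB PK maxB]]; apply/seteqP; split.
  by rewrite -HA; exact: maxB.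
by rewrite -KB; exact: maxA.
Qed.

Definition is_Pol : set G -> Prop :=
  greatest_inv_subgroup (fun H => poly_growth (@restr H)).

Definition is_Pinsker (R : realType) : set G -> Prop :=
  greatest_inv_subgroup (fun H => entropy (@restr H) R = 0%E).

End InvariantSubgroups.

(* Main.v *)
Require Import Defs.
From HB Require Import structures.
From mathcomp Require Import all_boot all_order all_algebra all_field finmap.
From mathcomp Require Import all_classical all_reals all_analysis.
From mathcomp Require Import ring lra zify.
Import Order.TTheory GRing.Theory Num.Theory.
Import numFieldNormedType.Exports.
Set Implicit Arguments.
Unset Strict Implicit.
Unset Printing Implicit Defensive.
Local Open Scope classical_set_scope.
Local Open Scope ring_scope.

(** Both equalities follow once three facts are known for an endomorphism
phi of an abelian group G, seen as a module over the polynomials in X with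
integer coefficients, X acting as phi.

The set frakQ consists of the elements killed by some product of differences
X^k - X^m with m < k ([frakQP]). Such products commute and may be multiplied,
so frakQ is an invariant subgroup.

If every element of G is in frakQ, then phi has polynomial growth. Measure a
polynomial by the sum of the absolute values of its coefficients. Dividing a
polynomial with n coefficients by X^k - X^m leaves a remainder that is not
larger and a quotient that is at most n times larger. Hence the remainder of a
polynomial modulo a fixed product of such differences has boundedly many
coefficients, of polynomially bounded size ([l1norm_mod_cycprod]). The elements of a trajectory
of length n are therefore among polynomially many combinations
([poly_growth_frakQ]). Polynomial growth gives entropy zero, since ln n / n
tends to 0.

If the entropy is zero, then every x is in frakQ. For every k > 0, the 2^n sums
over the subsets of {x, phi^k x, ..., phi^(k(n-1)) x} cannot be distinct for
all n, and a coincidence gives a monic polynomial in X^k with coefficients in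
{-1, 0, 1} that kills x. Let I be the ideal of the polynomials that kill x,
and h a nonzero element of minimal size in I, which divides all elements of I up
to constants. As I contains a monic polynomial, h is a constant c times a monic
integer polynomial g. A root z of g is such that z^k is at most 2 in modulus for
all k, by the bound on the roots of the polynomials above; so z is in the closed
unit disc. By Kronecker's theorem z^k = z^m for some m < k ([kronecker]), so g
divides a product w of differences X^k - X^m, and c w is in I. Finally, for a
monic f in I, pigeonhole modulo f and c gives m < k such that
(X^k - X^m) w is in I ([ideal_cycprod]).

Growth along the multiples of k says something about the entropy with respect
to a finite set only if the limit that defines it exists ([fekete]). *)

(** * Length of polynomials and division by X^k - X^m *)

Section LengthOfPolynomials.
Variable R : numDomainType.
Implicit Types p q : {poly R}.

Definition l1norm p : R := \sum_(i < size p) `|p`_i|.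

Lemma l1normE n p : (size p <= n)%N -> l1norm p = \sum_(i < n) `|p`_i|.
Proof.
move=> le_pn; rewrite /l1norm (big_ord_widen _ (fun i => `|p`_i|) le_pn).
rewrite big_mkcond /=; apply: eq_bigr => i _.
by case: ltnP => // le_pi; rewrite nth_default ?normr0.
Qed.

Lemma l1norm_ge0 p : 0 <= l1norm p.
Proof. by apply: sumr_ge0 => i _; exact: normr_ge0. Qed.

Lemma l1norm0 : l1norm 0 = 0.
Proof. by rewrite /l1norm size_poly0 big_ord0. Qed.

Lemma l1normD p q : l1norm (p + q) <= l1norm p + l1norm q.
Proof.
pose n := maxn (size p) (size q).
rewrite !(@l1normE n) ?leq_maxl ?leq_maxr ?size_polyD // -big_split /=.
by apply: ler_sum => i _; rewrite coefD ler_normD.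
Qed.

Lemma l1normZ c p : l1norm (c *: p) = `|c| * l1norm p.
Proof.
rewrite (l1normE (size_scale_leq c p)) /l1norm mulr_sumr.
by apply: eq_bigr => i _; rewrite coefZ normrM.
Qed.

Lemma l1norm_MXaddC p c : l1norm (p * 'X + c%:P) = l1norm p + `|c|.
Proof.
have le_s : (size (p * 'X + c%:P)%R <= (size p).+1)%N.
  by rewrite size_MXaddC; case: ifP.
rewrite (l1normE le_s) big_ord_recl coefD coefMX coefC /= add0r addrC.
by congr (_ + _); apply: eq_bigr => i _; rewrite coefD coefMX coefC /= addr0.
Qed.

Lemma l1normMX p : l1norm (p * 'X) = l1norm p.
Proof. by rewrite -[_ * _]addr0 -polyC0 l1norm_MXaddC normr0 addr0. Qed.

Lemma l1norm1 : l1norm 1 = 1.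
Proof. by rewrite -[1 in LHS]add0r -(mul0r 'X) l1norm_MXaddC l1norm0 add0r
  normr1. Qed.

Lemma l1normZXn c n : l1norm (c *: 'X^n) = `|c|.
Proof.
rewrite l1normZ; suff -> : l1norm 'X^n = 1 by rewrite mulr1.
by elim: n => [|n IHn]; [exact: l1norm1 | rewrite exprSr l1normMX].
Qed.

Lemma l1normM p q : l1norm (p * q) <= l1norm p * l1norm q.
Proof.
elim/poly_ind: p => [|p c IHp]; first by rewrite mul0r l1norm0 mul0r.
rewrite mulrDl -mulrA (mulrC 'X) mulrA mul_polyC (le_trans (l1normD _ _)) //.
by rewrite l1normMX l1normZ l1norm_MXaddC mulrDl lerD2r.
Qed.

Lemma norm_coef_l1norm p i : `|p`_i| <= l1norm p.
Proof.
have [lt_ip|le_pi] := ltnP i (size p).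
  by rewrite /l1norm (bigD1 (Ordinal lt_ip)) //= lerDl sumr_ge0.
by rewrite nth_default // normr0 l1norm_ge0.
Qed.

Lemma l1norm_prod (I : eqType) (s : seq I) (f : I -> {poly R}) B :
    (forall i, i \in s -> l1norm (f i) <= B) ->
  l1norm (\prod_(i <- s) f i) <= B ^+ size s.
Proof.
elim: s => [|i s IHs] leB /=; first by rewrite big_nil expr0 l1norm1.
rewrite big_cons exprS (le_trans (l1normM _ _)) //.
apply: ler_pM; rewrite ?l1norm_ge0 ?leB ?mem_head //.
by apply: IHs => j s_j; rewrite leB // inE s_j orbT.
Qed.

(** Modulo X^k - X^m, a leading term c X^n with n >= k may be replaced by
c X^(n - k + m), which has a lower degree and the same length; each of the at
most n replacements adds one monomial c X^(n - k) to the quotient, with |c|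
bounded by the length of p. *)
Lemma l1norm_divXnsubXm k m n p : (m < k)%N -> (size p <= n)%N ->
  exists q r, [/\ p = q * ('X^k - 'X^m) + r, (size q <= n)%N, (size r <= k)%N,
    l1norm q <= n%:R * l1norm p & l1norm r <= l1norm p].
Proof.
move=> lt_mk; elim: n p => [|n IHn] p le_pn.
  have -> : p = 0 by apply/eqP; rewrite -size_poly_leq0.
  by exists 0, 0; rewrite mul0r addr0 l1norm0 mulr0 size_poly0; split.
have [lt_nk|le_kn] := ltnP n k.
  exists 0, p; rewrite mul0r add0r size_poly0 l1norm0; split => //.
    exact: leq_trans lt_nk.
  by rewrite mulr_ge0 ?l1norm_ge0 ?ler0n.
pose c := p`_n; pose p1 := \poly_(i < n) p`_i.
have def_p : p = p1 + c *: 'X^n.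
  apply/polyP => i; rewrite coefD coef_poly coefZ coefXn.
  have [->|ne_in] := eqVneq i n; first by rewrite ltnn add0r mulr1.
  rewrite mulr0 addr0; case: ltnP => // le_ni; apply: nth_default.
  by rewrite (leq_trans le_pn) // ltn_neqAle eq_sym ne_in.
have len_p : l1norm p = l1norm p1 + `|c|.
  rewrite (l1normE le_pn) big_ord_recr /= (l1normE (size_poly _ _)).
  by congr (_ + _); apply: eq_bigr => i _; rewrite coef_poly ltn_ord.
pose p2 := p1 + c *: 'X^(n - k + m).
have lt_n : (n - k + m < n)%N by lia.
have size_p2 : (size p2 <= n)%N.
  rewrite (leq_trans (size_polyD _ _)) // geq_max size_poly.
  by rewrite (leq_trans (size_scale_leq _ _)) // size_polyXn.
have len_p2 : l1norm p2 <= l1norm p.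
  by rewrite (le_trans (l1normD _ _)) // l1normZXn len_p.
have [q [r [def_p2 size_q size_r len_q len_r]]] := IHn _ size_p2.
exists (q + c *: 'X^(n - k)), r; split => //.
- rewrite mulrDl !mulrBr -!scalerAl -!exprD subnK // {1}def_p.
  have -> : p1 = p2 - c *: 'X^(n - k + m) by rewrite addrK.
  by rewrite def_p2; ring.
- rewrite (leq_trans (size_polyD _ _)) // geq_max (leqW size_q) /=.
  by rewrite (leq_trans (size_scale_leq _ _)) // size_polyXn ltnS leq_subr.
- rewrite (le_trans (l1normD _ _)) // l1normZXn -natr1 mulrDl mul1r lerD //.
    by rewrite (le_trans len_q) // ler_wpM2l ?ler0n.
  by rewrite len_p lerDr l1norm_ge0.
- exact: le_trans len_p2.
Qed.

End LengthOfPolynomials.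

(** The pairs (k, m) stand for the exponents in the definition of Qn. *)
Definition cycprod (s : seq (nat * nat)) : {poly int} :=
  \prod_(u <- s) ('X^(u.1) - 'X^(u.2)).

Definition descending (s : seq (nat * nat)) := all (fun u => u.2 < u.1)%N s.

(** Each factor multiplies the length of the quotient by at most n + 1, and the
remainders of the successive divisions are combined with fixed coefficients. *)
Lemma l1norm_mod_cycprod s : descending s ->
  exists D : nat, exists2 C : int, 0 <= C & forall n (p : {poly int}), (size p
    <= n)%N ->
    exists q r, [/\ p = q * cycprod s + r, (size q <= n)%N, (size r <= D)%N,
      l1norm q <= n.+1%:R ^+ size s * l1norm p
    & l1norm r <= C * n.+1%:R ^+ size s * l1norm p].
Proof.
elim: s => [|[k m] s IHs] /=.
  move=> _; exists 0%N, 0 => // n p le_pn; exists p, 0.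
  rewrite /cycprod big_nil mulr1 addr0 size_poly0 l1norm0 expr0 mul1r !mul0r.
  by split.
case/andP=> /= lt_mk /IHs[D [C C0 divs]].
exists (maxn (k + size (cycprod s)) D), (l1norm (cycprod s) + C).
  by rewrite addr_ge0 ?l1norm_ge0.
move=> n p le_pn; have [q1 [r1 [def_p size_q1 size_r1 len_q1 len_r1]]] := divs
  _ _ le_pn.
have [q [r [def_q1 size_q size_r len_q len_r]]] := l1norm_divXnsubXm lt_mk
  size_q1.
exists q, (r * cycprod s + r1); split => //.
- rewrite {1}def_p {1}def_q1 /cycprod big_cons /=; ring.
- rewrite (leq_trans (size_polyD _ _)) // geq_max !leq_max size_r1 orbT andbT.
  by rewrite (leq_trans (size_polyMleq _ _)) // (leq_trans (leq_pred _))
    ?leq_add2r ?size_r.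
- rewrite exprS -mulrA (le_trans len_q) // ler_pM ?ler0n ?l1norm_ge0 //.
  by rewrite ler_nat.
- have step : n.+1%:R ^+ size s * l1norm p <= n.+1%:R ^+ (size s).+1 * l1norm p.
    by rewrite ler_wpM2r ?l1norm_ge0 // ler_weXn2l ?ler1n.
  rewrite (le_trans (l1normD _ _)) // -mulrA mulrDl lerD //.
    rewrite (le_trans (l1normM _ _)) // mulrC ler_wpM2l ?l1norm_ge0 //.
    exact: le_trans len_r (le_trans len_q1 step).
  by rewrite (le_trans len_r1) // -mulrA ler_wpM2l.
Qed.

(** * Kronecker's theorem on algebraic integers in the unit disc *)

Lemma pigeonhole_nat (T : finType) (f : nat -> T) :
  exists i j, (i < j)%N /\ f i = f j.
Proof.
have /injectivePn[i [j ne_ij eq_f]] :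
    ~~ injectiveb (fun i : 'I_(#|T|.+1) => f i).
  apply/negP => /injectiveP/leq_card; by rewrite card_ord ltnn.
have [lt_ij|lt_ji|eq_ij] := ltngtP i j.
- by exists i, j.
- by exists j, i.
- by case/eqP: ne_ij; exact: val_inj.
Qed.

Lemma shifted_absz_inj (B : nat) (a b : int) : `|a| <= B%:Z -> `|b| <= B%:Z ->
  inord (absz (a + B%:Z)) = inord (absz (b + B%:Z)) :> 'I_(B.*2.+1) -> a = b.
Proof. by move=> le_a le_b /(congr1 val); rewrite /= !inordK; lia. Qed.

Lemma pigeonhole_bounded_poly (T : finType) (P : nat -> {poly int}) (g : nat ->
  T)
    (n B : nat) :
    (forall j, size (P j) <= n)%N -> (forall j i, `|(P j)`_i| <= B%:Z) ->
  exists i j, [/\ (i < j)%N, P i = P j & g i = g j].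
Proof.
move=> size_P bound_P.
pose code j : {ffun 'I_n -> 'I_(B.*2.+1)} * T :=
  ([ffun i : 'I_n => inord (absz ((P j)`_i + B%:Z))], g j).
have [i [j [lt_ij [eq_code eq_g]]]] := pigeonhole_nat code.
exists i, j; split => //; apply/polyP => l.
have [lt_ln|le_nl] := ltnP l n; last first.
  by rewrite !nth_default // (leq_trans _ le_nl).
have /(congr1 (fun c : {ffun 'I_n -> 'I_(B.*2.+1)} => c (Ordinal lt_ln))) :=
  eq_code.
by rewrite !ffunE; exact: shifted_absz_inj.
Qed.

(** Graeffe's root squaring: writing P = e(X^2) + X o(X^2), the product
P(X) P(-X) = e(X^2)^2 - X^2 o(X^2)^2 is an integer polynomial in X^2, and it is,
up to sign, the product of the X^2 - z^2. *)
Lemma graeffe (P : {poly int}) (rs : seq algC) :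
    map_poly intr P = \prod_(z <- rs) ('X - z%:P) ->
  exists P' : {poly int}, map_poly intr P' = \prod_(z <- rs) ('X - (z ^+ 2)%:P).
Proof.
move=> def_P; pose e := even_poly P; pose o := odd_poly P.
exists ((-1) ^+ size rs *: (e * e - 'X * (o * o))).
pose f : {rmorphism int -> algC} := intr.
apply/eqP; rewrite -subr_eq0 -(@comp_poly_eq0 _ _ 'X^2) ?size_polyXn //.
rewrite rmorphB /= subr_eq0; apply/eqP.
pose E := map_poly f e \Po 'X^2; pose O := map_poly f o \Po 'X^2.
have PE : map_poly f P = E + O * 'X.
  by rewrite -[in LHS](poly_even_odd P) rmorphD rmorphM /= !map_comp_poly
    map_polyXn map_polyX.
have PN : map_poly f P \Po (- 'X) = E - O * 'X.
  rewrite PE rmorphD rmorphM /= /E /O -!comp_polyA comp_polyX.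
  by rewrite comp_Xn_poly sqrrN mulrN.
have -> : \prod_(z <- rs) ('X - (z ^+ 2)%:P) \Po 'X^2
        = (-1) ^+ size rs *: (map_poly f P * (map_poly f P \Po - 'X)).
  rewrite def_P {def_P E O PE PN}.
  elim: rs => [|z rs IHrs] /=.
    by rewrite !big_nil expr0 scale1r mul1r !rmorph1.
  rewrite !big_cons !rmorphM /= IHrs.
  rewrite comp_polyB comp_polyM !comp_polyC comp_polyX comp_polyB comp_polyX
    comp_polyC (exprS (-1)).
  rewrite -!mul_polyC [(-1 * _)%:P]rmorphM rmorphN rmorph1 /=.
  set w := ((-1) ^+ size rs)%:P; set A := \prod_(j <- rs) _; set B := A \Po _.
  ring.
rewrite PN PE map_polyZ comp_polyZ rmorphXn rmorphN1; congr (_ *: _).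
rewrite rmorphB !rmorphM /= map_polyX comp_polyB !comp_polyM.
rewrite comp_polyX -/E -/O.
ring.
Qed.

Lemma graeffe_iter (P : {poly int}) (rs : seq algC) j :
    map_poly intr P = \prod_(z <- rs) ('X - z%:P) ->
  exists P' : {poly int}, map_poly intr P' == \prod_(z <- rs) ('X - (z ^+ (2 ^
    j))%:P).
Proof.
move=> def_P; elim: j => [|j [Pj /eqP def_Pj]].
  by exists P; rewrite def_P.
have [|P' def_P'] := @graeffe Pj [seq z ^+ (2 ^ j) | z <- rs].
  by rewrite big_map.
exists P'; rewrite def_P' big_map; apply/eqP/eq_bigr => z _.
by rewrite -exprM expnSr.
Qed.

(** The integer polynomials with roots z^(2^j) have coefficients bounded by
2^(size rs), so they are finitely many, and two indices j give the same
polynomial with z^(2^j) at the same position in its list of roots. Only powers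
of two are used as exponents because root squaring keeps the coefficients
integer. *)
Lemma kronecker (P : {poly int}) (rs : seq algC) :
    map_poly intr P = \prod_(z <- rs) ('X - z%:P) ->
    (forall z, z \in rs -> `|z| <= 1) ->
  forall z, z \in rs -> exists k m, (m < k)%N /\ z ^+ k = z ^+ m.
Proof.
move=> def_P le1 z rs_z.
pose Pj j := xchoose (graeffe_iter j def_P).
have def_Pj j : map_poly intr (Pj j) = \prod_(z <- rs) ('X - (z ^+ (2 ^ j))%:P).
  exact/eqP/(xchooseP (graeffe_iter j def_P)).
pose rts (Q : {poly int}) : seq algC :=
  sval (closed_field_poly_normal (map_poly intr Q)).
have rts_z j : z ^+ (2 ^ j) \in rts (Pj j).
  rewrite /rts; case: closed_field_poly_normal => ws /= def_ws.
  have : root (map_poly intr (Pj j)) (z ^+ (2 ^ j)).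
    rewrite def_Pj -(big_map (fun z => z ^+ (2 ^ j)) xpredT (fun z => 'X -
      z%:P)).
    by rewrite root_prod_XsubC; exact: (map_f (fun w => w ^+ (2 ^ j)) rs_z).
  rewrite def_ws rootZ ?root_prod_XsubC // def_Pj.
  by rewrite (monicP (monic_prod_XsubC _ _ _)) oner_eq0.
have size_Pj j : size (Pj j) = (size rs).+1.
  rewrite -(size_map_inj_poly (f := intr : int -> algC)) //;
    last exact: intr_inj.
  by rewrite def_Pj size_prod_XsubC.
have size_rts j : size (rts (Pj j)) = size rs.
  have := size_Pj j; rewrite -(size_map_inj_poly (f := intr : int -> algC)) //;
    last exact: intr_inj.
  rewrite /rts; case: closed_field_poly_normal => ws /= {1}->.
  rewrite size_scale ?size_prod_XsubC; first by case.
  by rewrite def_Pj (monicP (monic_prod_XsubC _ _ _)) oner_eq0.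
(* the roots are listed by a function of the polynomial, so that equal
   polynomials and equal positions give equal roots *)
have [||i [j [lt_ij eq_P eq_ix]]] := @pigeonhole_bounded_poly 'I_(size rs).+1 Pj
    (fun j => inord (index (z ^+ (2 ^ j)) (rts (Pj j)))) (size rs).+1 (2 ^ size
      rs).
- by move=> j; rewrite size_Pj.
- move=> j i; rewrite -(ler_int algC) intr_norm -coef_map /=.
  rewrite (le_trans (norm_coef_l1norm _ _)) // def_Pj.
  rewrite -[(Posz _)%:~R]/((2 ^ size rs)%:R) natrX l1norm_prod // => x rs_x.
  rewrite -['X]mul1r -polyCN l1norm_MXaddC l1norm1 normrN normrX.
  by rewrite (_ : 2 = 1 + 1 :> algC) // lerD2l exprn_ile1 ?le1.
exists (2 ^ j)%N, (2 ^ i)%N; split; first by rewrite ltn_exp2l.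
have /(congr1 val) := eq_ix.
rewrite /= !inordK ?ltnS -?(size_rts i) -?(size_rts j) ?index_size //.
  by move=> eq_index; rewrite -(nth_index 0 (rts_z i)) -(nth_index 0 (rts_z j))
    eq_index eq_P.
by rewrite size_rts -(size_rts j) index_size.
Qed.

(** Otherwise |z|^n <= 1 + |z| + ... + |z|^(n - 1) = (|z|^n - 1) / (|z| - 1)
would be less than |z|^n. *)
Lemma cauchy_bound (g : {poly int}) (z : algC) :
    g \is monic -> (forall i, `|g`_i| <= 1) -> root (map_poly intr g) z ->
  `|z| <= 2.
Proof.
move=> mon_g le1 /rootP gz0.
have [n size_g] : exists n, size g = n.+1.
  by exists (size g).-1; rewrite prednK // size_poly_gt0 monic_neq0.
have zn : z ^+ n = - \sum_(i < n) (g`_i)%:~R * z ^+ i.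
  have := gz0; rewrite (@horner_coef_wide _ n.+1) ?big_ord_recr /=; last first.
    by rewrite (leq_trans (size_poly _ _)) ?size_g.
  rewrite coef_map /= (_ : g`_n = 1) ?mul1r; last first.
    by have /monicP := mon_g; rewrite /lead_coef size_g.
  under eq_bigr do rewrite coef_map /=.
  by move/eqP; rewrite addrC addr_eq0 => /eqP.
have le_sum : `|z| ^+ n <= \sum_(i < n) `|z| ^+ i.
  rewrite -normrX zn normrN (le_trans (ler_norm_sum _ _ _)) // ler_sum // => i
    _.
  rewrite normrM normrX -[leRHS]mul1r ler_wpM2r ?exprn_ge0 //.
  by rewrite -intr_norm -[1]/(1%:~R) ler_int.
rewrite real_leNgt ?realn // ?normr_real //; apply/negP => gt2.
have x1 : 1 < `|z| - 1 by rewrite ltrBrDr.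
have : (`|z| - 1) * `|z| ^+ n <= `|z| ^+ n - 1.
  by rewrite subrX1 ler_wpM2l // ltW // (lt_trans ltr01).
have : `|z| ^+ n <= (`|z| - 1) * `|z| ^+ n.
  by rewrite -[leLHS]mul1r ler_wpM2r ?exprn_ge0 // ltW.
move=> a b; have := le_trans a b.
by rewrite lerDl oppr_ge0 ler10.
Qed.

(** If x = 1 + t with t > 0, Bernoulli's inequality makes the powers of x
unbounded. *)
Lemma le1_of_bounded_powers (x B : algC) : 0 <= x ->
  (forall k, (0 < k)%N -> x ^+ k <= B) -> x <= 1.
Proof.
move=> x0 leB; rewrite real_leNgt ?ger0_real //; apply/negP => lt1x.
have [t t0 def_x] : exists2 t : algC, 0 < t & x = 1 + t.
  by exists (x - 1); rewrite ?subr_gt0 ?subrKC.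
have bern k : 1 + k%:R * t <= x ^+ k.
  elim: k => [|k IHk]; first by rewrite mul0r addr0 expr0.
  rewrite exprS; apply: le_trans (ler_wpM2l x0 IHk).
  have -> : x * (1 + k%:R * t) = 1 + k.+1%:R * t + k%:R * (t * t).
    by rewrite def_x -natr1; ring.
  by rewrite lerDl mulr_ge0 ?ler0n // mulr_ge0 ?ltW.
have B0 : 0 <= B by rewrite (le_trans _ (leB 1%N isT)) ?expr1.
have := archi_boundP (divr_ge0 B0 (ltW t0)); set k := Num.bound _ => ltk.
have := leB k.+1 isT; apply/negP; rewrite -real_ltNge ?ger0_real ?exprn_ge0 //.
have ltB : B < k.+1%:R * t.
  by rewrite -ltr_pdivrMr //; apply: lt_trans ltk _; rewrite ltr_nat.
by apply: lt_le_trans (bern _); rewrite (lt_trans ltB) // ltrDr ltr01.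
Qed.

(** * Ideals of integer polynomials with small monic elements *)

(** The quotient of the integer polynomials by f and c is finite, so the powers
of X repeat in it. *)
Lemma XnsubXm_mod_monic (f : {poly int}) (c : int) : f \is monic -> c != 0 ->
  exists k m a b, (m < k)%N /\ 'X^k - 'X^m = a * f + c *: b.
Proof.
move=> mon_f c0; pose r j := Pdiv.CommonRing.rmodp 'X^j f.
pose P j := \poly_(i < size f) ((r j)`_i %% c)%Z.
have [||m [k [lt_mk eq_P _]]] := @pigeonhole_bounded_poly unit P
    (fun=> tt) (size f) (absz c).
- by move=> j; exact: size_poly.
- move=> j i; rewrite coef_poly; case: ifP => _; last by rewrite normr0.
  by rewrite ger0_norm ?modz_ge0 // abszE ltW // ltz_mod.
have size_r j : (size (r j) < size f)%N.
  by rewrite Pdiv.Ring.ltn_rmodp monic_neq0.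
exists k, m, (Pdiv.CommonRing.rdivp 'X^k f - Pdiv.CommonRing.rdivp 'X^m f).
exists (\poly_(i < size f) (((r k)`_i %/ c)%Z - ((r m)`_i %/ c)%Z)).
split=> //.
rewrite {1}(Pdiv.RingMonic.rdivp_eq mon_f 'X^k) {1}(Pdiv.RingMonic.rdivp_eq
  mon_f 'X^m).
rewrite -/(r k) -/(r m) mulrBl -!addrA; congr (_ + _).
rewrite opprD addrCA; congr (_ + _).
apply/polyP => i; rewrite coefB coefZ coef_poly.
case: ltnP => [lt_if|le_fi]; last first.
  by rewrite !nth_default ?mulr0 ?subr0 // ltnW // (leq_trans (size_r _)).
have := congr1 (fun Q : {poly int} => Q`_i) eq_P;
  rewrite !coef_poly lt_if => eq_mod.
rewrite {1}(divz_eq (r k)`_i c) {1}(divz_eq (r m)`_i c) eq_mod.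
ring.
Qed.

(** One difference X^k - X^m is used for each root, counted with multiplicity,
so repeated roots need no separate treatment. *)
Lemma root_factors_dvd_cycprod (rs : seq algC) :
    (forall z, z \in rs -> exists k m, (m < k)%N /\ z ^+ k = z ^+ m) ->
  exists2 s, descending s &
    \prod_(z <- rs) ('X - z%:P) %| map_poly intr (cycprod s).
Proof.
elim: rs => [|z rs IHrs] tors; first by exists [::]; rewrite // big_nil dvd1p.
have [|s desc_s dvd_s] := IHrs; first by move=> x rs_x; apply: tors;
  rewrite inE rs_x orbT.
have [k [m [lt_mk eq_z]]] := tors z (mem_head _ _).
exists ((k, m) :: s); first by rewrite /= lt_mk.
rewrite /cycprod !big_cons rmorphM /= dvdp_mul // rmorphB /= !map_polyXn.
by rewrite dvdp_XsubCl /root hornerD hornerN !hornerXn eq_z subrr.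
Qed.

(** Division with remainder by a monic polynomial commutes with the extension of
scalars. *)
Lemma monic_dvd_int_of_algC (g w : {poly int}) : g \is monic ->
  map_poly (intr : int -> algC) g %| map_poly intr w -> exists a, w = a * g.
Proof.
move=> mon_g; rewrite [w](Pdiv.RingMonic.rdivp_eq mon_g).
set a := Pdiv.CommonRing.rdivp _ _; set b := Pdiv.CommonRing.rmodp _ _.
rewrite rmorphD rmorphM /= dvdp_addr ?dvdp_mull // => dvd_b.
have size_b : (size b < size g)%N by rewrite Pdiv.Ring.ltn_rmodp monic_neq0.
suff -> : b = 0 by exists a; rewrite addr0.
apply: contraTeq dvd_b => b0; rewrite gtNdvdp //.
  by rewrite -size_poly_eq0 size_map_inj_poly ?size_poly_eq0 //;
    exact: intr_inj.
by rewrite !size_map_inj_poly //; exact: intr_inj.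
Qed.

Section IdealsOfIntegerPolynomials.
Variable I : {poly int} -> Prop.
Hypothesis ideal_add : forall p q, I p -> I q -> I (p + q).
Hypothesis ideal_mul : forall p q, I q -> I (p * q).

(** A pseudo-remainder modulo h is an element of the ideal smaller than h. *)
Lemma ideal_min_size p : I p -> p != 0 ->
  exists2 h, I h /\ h != 0 & forall q, I q -> h %| q.
Proof.
move=> Ip p0.
have [h [Ih h0] min_h] : exists2 h, I h /\ h != 0 &
    forall q, I q -> q != 0 -> (size h <= size q)%N.
  have [n] := ubnP (size p); elim: n p Ip p0 => // n IHn p Ip p0 le_pn.
  have [[q [Iq q0 lt_qp]]|min_p] := pselect (exists q, [/\ I q, q != 0 & (size
    q < size p)%N]).
    by apply: (IHn q) => //; exact: leq_trans lt_qp _.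
  exists p => // q Iq q0; rewrite leqNgt; apply/negP => lt_qp.
  by apply: min_p; exists q.
exists h => // q Iq.
have [r0|r0] := eqVneq (q %% h) 0; first by rewrite /dvdp r0.
suff Ir : I (q %% h) by have := min_h _ Ir r0; rewrite leqNgt ltn_modp h0.
have -> : q %% h = (lead_coef h ^+ scalp q h)%:P * q + (- (q %/ h)) * h.
  by rewrite mul_polyC Pdiv.Idomain.divp_eq mulNr addrAC subrr add0r.
by apply: ideal_add; apply: ideal_mul.
Qed.

(** With k = 1 the hypothesis makes the primitive part of a generator h over the
rationals monic up to sign; with all k it puts the roots of h in the closed unit
disc. *)
Lemma ideal_cycprod :
    (forall k, (0 < k)%N -> exists g : {poly int},
       [/\ g \is monic, forall i, `|g`_i| <= 1 & I (g \Po 'X^k)]) ->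
  exists2 s, descending s & I (cycprod s).
Proof.
move=> small_monic.
have [f [mon_f _ If]] := small_monic 1%N isT; rewrite expr1 comp_polyXr in If.
have [h [Ih h0] dvd_h] := ideal_min_size If (monic_neq0 mon_f).
(* g is monic up to its leading coefficient u, a unit, and g1 is monic *)
pose g := zprimitive h; pose c := zcontents h.
have dvd_g q : I q -> exists r, q = g * r.
  by move=> /dvd_h/dvdpP_int[r ->]; exists r.
have [r def_f] := dvd_g _ If.
pose u := lead_coef g.
have [v uv1] : exists v, u * v = 1.
  by exists (lead_coef r); rewrite -lead_coefM -def_f (monicP mon_f).
have u0 : u != 0 by apply: contra_eq_neq uv1 => ->; rewrite mul0r.
have uu1 : u * u = 1.
  have : u \is a GRing.unit by apply/unitrP; exists v; rewrite mulrC uv1.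
  by case/orP => /eqP ->.
pose g1 := u *: g.
have def_h : h = (c * u) *: g1.
  by rewrite scalerA -mulrA uu1 mulr1 [LHS]zpolyEprim.
have mon_g1 : g1 \is monic by rewrite monicE lead_coefZ -/u uu1.
have [rs def_g1] := closed_field_poly_normal (map_poly (intr : int -> algC) g1).
have mon_mg1 : map_poly (intr : int -> algC) g1 \is monic by exact: monic_map.
rewrite (monicP mon_mg1) scale1r in def_g1.
have le1 z : z \in rs -> `|z| <= 1.
  move=> rs_z; apply: (@le1_of_bounded_powers _ 2) => // k k0.
  have [gk [mon_gk le1_gk Igk]] := small_monic k k0.
  rewrite -normrX; apply: (cauchy_bound mon_gk le1_gk).
  have [rk def_gk] := dvd_g _ Igk.
  have gz0 : root (map_poly intr g) z.
    have : root (map_poly intr g1) z by rewrite def_g1 root_prod_XsubC.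
    by rewrite map_polyZ rootZ //= intr_eq0.
  have /(congr1 (fun p => (map_poly intr p).[z])) := def_gk.
  rewrite rmorphM /= map_comp_poly /= map_polyXn horner_comp hornerXn hornerM.
  by rewrite (rootP gz0) mul0r => /rootP.
have [s desc_s dvd_s] := root_factors_dvd_cycprod (kronecker def_g1 le1).
rewrite -def_g1 in dvd_s.
have [a def_w] := monic_dvd_int_of_algC mon_g1 dvd_s.
(* the contents c * u of h are removed at the cost of one more difference *)
have Icw : I ((c * u) *: cycprod s).
  by rewrite def_w scalerAr -def_h; exact: ideal_mul.
have cu0 : c * u != 0 by rewrite mulf_neq0 // zcontents_eq0.
have [k [m [a' [b [lt_mk def_km]]]]] := XnsubXm_mod_monic mon_f cu0.
exists ((k, m) :: s); first by rewrite /= lt_mk.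
rewrite /cycprod big_cons /= def_km -/(cycprod s) mulrDl.
rewrite mulrAC -scalerAl scalerAr.
by apply: ideal_add; apply: ideal_mul.
Qed.

End IdealsOfIntegerPolynomials.

(** * Action of polynomials, trajectories and growth *)

Section PolynomialAction.
Variables (G : zmodType) (phi : {additive G -> G}).
Implicit Types (p q : {poly int}) (x y : G).

Lemma iter_is_zmod_morphism i : zmod_morphism (iter i phi).
Proof. by elim: i => [|i IHi] x y //=; rewrite IHi raddfB. Qed.

HB.instance Definition _ i :=
  GRing.isZmodMorphism.Build G G (iter i phi) (iter_is_zmod_morphism i).

Definition act p x : G := \sum_(i < size p) iter i phi x *~ p`_i.

Lemma actE n p x : (size p <= n)%N -> act p x = \sum_(i < n) iter i phi x *~
  p`_i.
Proof.
move=> le_pn; rewrite /act (big_ord_widen _ (fun i => iter i phi x *~ p`_i)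
  le_pn).
rewrite big_mkcond /=; apply: eq_bigr => i _.
by case: ltnP => // le_pi; rewrite nth_default ?mulr0z.
Qed.

Lemma act0 x : act 0 x = 0.
Proof. by rewrite /act size_poly0 big_ord0. Qed.

Lemma actD p q x : act (p + q) x = act p x + act q x.
Proof.
pose n := maxn (size p) (size q).
rewrite !(@actE n) ?leq_maxl ?leq_maxr ?size_polyD // -big_split /=.
by apply: eq_bigr => i _; rewrite coefD mulrzDr.
Qed.

Lemma actZ c p x : act (c *: p) x = act p x *~ c.
Proof.
rewrite (actE _ (size_scale_leq c p)) /act mulrz_suml.
by apply: eq_bigr => i _; rewrite coefZ mulrC mulrzA.
Qed.

Lemma act1 x : act 1 x = x.
Proof. by rewrite /act size_poly1 big_ord1 coef1 /= mulr1z. Qed.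

Lemma actMX p x : act (p * 'X) x = phi (act p x).
Proof.
have le_s : (size (p * 'X)%R <= (size p).+1)%N.
  by rewrite (leq_trans (size_polyMleq _ _)) // size_polyX addn2.
rewrite (actE _ le_s) big_ord_recl coefMX /= mulr0z add0r raddf_sum.
by apply: eq_bigr => i _; rewrite coefMX /= raddfMz.
Qed.

Lemma actXn n x : act 'X^n x = iter n phi x.
Proof. by elim: n => [|n IHn]; rewrite ?expr0 ?act1 // exprSr actMX IHn. Qed.

Lemma act_sum I (s : seq I) (f : I -> {poly int}) x :
  act (\sum_(i <- s) f i) x = \sum_(i <- s) act (f i) x.
Proof. by apply: (big_morph (act^~ x)) => [p q|]; rewrite ?actD ?act0. Qed.

Lemma actM p q x : act (p * q) x = act p (act q x).
Proof.
elim/poly_ind: p => [|p c IHp]; first by rewrite mul0r !act0.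
rewrite mulrDl mulrAC mul_polyC !actD !actMX IHp actZ.
by rewrite -(mulr1 c%:P) mul_polyC actZ act1.
Qed.

Lemma actr_is_zmod_morphism p : zmod_morphism (act p).
Proof.
move=> x y; rewrite /act -sumrB; apply: eq_bigr => i _.
by rewrite raddfB mulrzBl.
Qed.

HB.instance Definition _ p :=
  GRing.isZmodMorphism.Build G G (act p) (actr_is_zmod_morphism p).

Lemma act_phi p x : act p (phi x) = phi (act p x).
Proof. by rewrite -[phi x](actXn 1) -actM expr1 actMX. Qed.

Lemma act_comp_Xn p k x :
  act (p \Po 'X^k) x = \sum_(i < size p) iter (k * i) phi x *~ p`_i.
Proof.
rewrite comp_polyE act_sum; apply: eq_bigr => i _.
by rewrite actZ -exprM actXn.
Qed.

Lemma act_cycprod_cons k m s x :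
  act (cycprod ((k, m) :: s)) x = act (cycprod s) (iter k phi x - iter m phi x).
Proof.
rewrite /cycprod big_cons mulrC actM /=; congr act.
by rewrite actD -scaleN1r actZ !actXn mulrN1z.
Qed.

(** Unfolding Qn amounts to applying the factors of a product one by one. *)
Lemma QnP n x : Qn phi n x <->
  exists s, [/\ descending s, size s = n & act (cycprod s) x = 0].
Proof.
elim: n x => [|n IHn] x /=; split.
- by move=> ->; exists [::]; split; rewrite ?raddf0.
- by case=> s [_ /size0nil -> ]; rewrite /cycprod big_nil act1.
- case=> k [m [lt_mk /IHn[s [desc_s size_s ann_s]]]]; exists ((k, m) :: s).
  by rewrite act_cycprod_cons /= size_s lt_mk; split.
case=> -[|[k m] s] [/= desc_s size_s ann_s] //;
  have [lt_mk desc_s'] := ssrbool.andP desc_s;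
    have {}size_s := succn_inj size_s.
exists k, m; split => //; apply/IHn; exists s; split => //.
by rewrite -act_cycprod_cons.
Qed.

Lemma frakQP x :
  frakQ phi x <-> exists2 s, descending s & act (cycprod s) x = 0.
Proof.
split; first by case=> n _ /QnP[s [desc_s _ ann_s]]; exists s.
by case=> s desc_s ann_s; exists (size s) => //; apply/QnP; exists s.
Qed.

Lemma cycprod_cat s1 s2 : cycprod (s1 ++ s2) = cycprod s1 * cycprod s2.
Proof. exact: big_cat. Qed.

Lemma frakQ0 : frakQ phi 0.
Proof. by apply/frakQP; exists [::]; rewrite ?raddf0. Qed.

(** Concatenating two lists multiplies the products, and the result kills both
elements. *)
Lemma frakQB x y : frakQ phi x -> frakQ phi y -> frakQ phi (x - y).
Proof.
move=> /frakQP[s desc_s ann_s] /frakQP[t desc_t ann_t]; apply/frakQP.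
exists (s ++ t); first by rewrite [descending _]all_cat; apply/andP; split.
by rewrite cycprod_cat raddfB /= (actM _ _ y) mulrC (actM _ _ x) ann_s ann_t
  !raddf0 addr0.
Qed.

Lemma frakQ_phi x : frakQ phi x -> frakQ phi (phi x).
Proof.
move=> /frakQP[s desc_s ann_s]; apply/frakQP; exists s => //.
by rewrite act_phi ann_s raddf0.
Qed.

Definition frakQ_subgroup : inv_subgroup phi :=
  InvSubgroup frakQ0 frakQB frakQ_phi.

Lemma minkowskiP (A B : {fset G}) t :
  reflect (exists x y, [/\ x \in A, y \in B & t = x + y]) (t \in Defs.minkowski
    A B).
Proof.
apply: (iffP idP) => [/imfset2P[x Ax [y By ->]]|[x [y [Ax By ->]]]].
  by exists x, y.
exact: in_imfset2.
Qed.

Lemma minkowskiA : associative (@Defs.minkowski G).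
Proof.
move=> A B C; apply/fsetP => t; apply/minkowskiP/minkowskiP.
  case=> x [_ [Ax /minkowskiP[y [z [By Cz ->]]] ->]].
  exists (x + y), z; split; rewrite ?addrA //.
  by apply/minkowskiP; exists x, y.
case=> _ [z [/minkowskiP[x [y [Ax By ->]]] Cz ->]].
exists x, (y + z); split; rewrite ?addrA //.
by apply/minkowskiP; exists y, z.
Qed.

Lemma minkowski0s : left_id [fset 0%R]%fset (@Defs.minkowski G).
Proof.
move=> A; apply/fsetP => t; apply/minkowskiP/idP.
  by case=> _ [y [/fset1P -> Ay ->]]; rewrite add0r.
by move=> At; exists 0, t; rewrite fset11 add0r.
Qed.

Lemma minkowskis0 : right_id [fset 0%R]%fset (@Defs.minkowski G).
Proof.
move=> A; apply/fsetP => t; apply/minkowskiP/idP.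
  by case=> x [_ [Ax /fset1P -> ->]]; rewrite addr0.
by move=> At; exists t, 0; rewrite fset11 addr0.
Qed.

HB.instance Definition _ := Monoid.isLaw.Build {fset G} [fset 0%R]%fset
  (@Defs.minkowski G) minkowskiA minkowski0s minkowskis0.

Lemma trajectoryP (F : {fset G}) n t :
  (t \in trajectory phi F n) <->
  exists2 c : nat -> G, (forall i, (i < n)%N -> c i \in F) &
    t = \sum_(i < n) iter i phi (c i).
Proof.
rewrite /trajectory; elim: n t => [|n IHn] t.
  rewrite big_ord0; split; last by case=> c _ ->; rewrite big_ord0 fset11.
  by move=> /fset1P ->; exists (fun=> 0); rewrite ?big_ord0.
rewrite big_ord_recr /=; split.
  case/minkowskiP=> x [_ [/IHn[c Fc ->] /imfsetP[y /= Fy ->] ->]].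
  exists (fun i => if i == n then y else c i).
    move=> i; case: eqP => // /eqP ne_in; rewrite ltnS leq_eqVlt (negPf ne_in).
    exact: Fc.
  rewrite big_ord_recr /= eqxx; congr (_ + _).
  by apply: eq_bigr => i _; rewrite ltn_eqF.
case=> c Fc ->; rewrite big_ord_recr /=; apply/minkowskiP.
exists (\sum_(i < n) iter i phi (c i)), (iter n phi (c n)); split => //.
  by apply/IHn; exists c => // i lt_in; apply: Fc; exact: leqW.
by apply: in_imfset => /=; exact: Fc.
Qed.

Lemma trajectory_addP (F : {fset G}) m n t :
  (t \in trajectory phi F (m + n)) <->
  exists u v, [/\ u \in trajectory phi F m, v \in trajectory phi F n
                & t = u + iter m phi v].
Proof.
split.
  case/trajectoryP=> c Fc ->; rewrite big_split_ord /=.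
  exists (\sum_(i < m) iter i phi (c i)), (\sum_(i < n) iter i phi (c (m +
    i)%N)).
  split; first by apply/trajectoryP; exists c => // i lt_im;
    rewrite Fc ?ltn_addr.
    by apply/trajectoryP; exists (fun i => c (m + i)%N) => // i lt_in;
      rewrite Fc ?ltn_add2l.
  by rewrite raddf_sum; congr (_ + _); apply: eq_bigr => i _; rewrite iterD.
case=> _ [_ [/trajectoryP[c Fc ->] /trajectoryP[d Fd ->] ->]].
apply/trajectoryP; exists (fun i => if (i < m)%N then c i else d (i - m)%N).
  move=> i lt_i; case: (ltnP i m) => [|le_mi]; first exact: Fc.
  by apply: Fd; rewrite ltn_subLR.
rewrite big_split_ord /= raddf_sum; congr (_ + _); apply: eq_bigr => i _.
  by rewrite ltn_ord.
by rewrite ltnNge leq_addr addKn iterD.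
Qed.

Lemma tau0 (F : {fset G}) : tau phi F 0 = 1%N.
Proof. by rewrite /tau /trajectory big_ord0 cardfs1. Qed.

Lemma tau_gt0 (F : {fset G}) n : F != fset0 -> (0 < tau phi F n)%N.
Proof.
case/fset0Pn => x Fx; rewrite /tau cardfs_gt0; apply/fset0Pn.
by exists (\sum_(i < n) iter i phi x); apply/trajectoryP; exists (fun=> x).
Qed.

(** A trajectory of length m + n is the sum of the one of length m and of the
image of the one of length n under phi^m. *)
Lemma tau_submultiplicative (F : {fset G}) m n :
  (tau phi F (m + n) <= tau phi F m * tau phi F n)%N.
Proof.
rewrite /tau -(size_allpairs (fun u v => u + iter m phi v)).
apply: uniq_leq_size => [|t /trajectory_addP[u [v [Tu Tv ->]]]];
  first exact: fset_uniq.
exact: (allpairs_f (fun u v => u + iter m phi v)).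
Qed.

Lemma tau_mul_leq (F : {fset G}) k n : (tau phi F (k * n) <= tau phi F n ^ k)%N.
Proof.
elim: k => [|k IHk]; first by rewrite mul0n tau0.
by rewrite mulSn expnS (leq_trans (tau_submultiplicative _ _ _)) // leq_mul2l
  IHk orbT.
Qed.

Lemma sparse_sum_in_trajectory k (e : nat -> bool) x n : (0 < k)%N ->
  \sum_(j < n) iter (k * j) phi x *~ (e j)%:Z \in trajectory phi [fset 0%R;
    x]%fset (k * n).
Proof.
case: k => // k _; elim: n => [|n IHn].
  by rewrite big_ord0 muln0 /trajectory big_ord0 fset11.
rewrite big_ord_recr mulnSr; apply/trajectory_addP.
exists (\sum_(j < n) iter (k.+1 * j) phi x *~ (e j)%:Z), (if e n then x else 0).
split => //; last by case: (e n); rewrite ?mulr1z ?mulr0z ?raddf0.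
apply/trajectoryP; exists (fun i => if (i == 0) && e n then x else 0).
  by move=> i _; rewrite !inE; case: ifP; rewrite eqxx ?orbT.
rewrite big_ord_recl /= big1 ?addr0 // => i _.
by rewrite -iterS raddf0.
Qed.

(** Two equal sums over distinct subsets of {x, phi^k x, ...} differ by a
polynomial in X^k with coefficients in {-1, 0, 1}, which becomes monic after
multiplication by its leading coefficient. *)
Lemma exponential_tau x k :
    (0 < k)%N ->
    (forall g : {poly int}, g \is monic -> (forall i, `|g`_i| <= 1) ->
       act (g \Po 'X^k) x != 0) ->
  forall n, (2 ^ n <= tau phi [fset 0%R; x]%fset (k * n))%N.
Proof.
move=> k0 no_rel n.
pose f (e : {ffun 'I_n -> bool}) := \sum_(j < n) iter (k * j) phi x *~ (e j)%:Z.
have f_in e : f e \in trajectory phi [fset 0%R; x]%fset (k * n).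
  pose e' i := if insub i is Some j then e j else false.
  suff -> : f e = \sum_(j < n) iter (k * j) phi x *~ (e' j)%:Z.
    exact: sparse_sum_in_trajectory.
  by apply: eq_bigr => j _; rewrite /e' valK.
have inj_f : injective f.
  move=> e e' eq_f; apply/eqP; apply: contraT => ne_e.
  pose P := \poly_(j < n) (if insub j is Some i then (e i)%:Z - (e' i)%:Z else
    0).
  have P_j (j : 'I_n) : P`_j = (e j)%:Z - (e' j)%:Z.
    by rewrite coef_poly ltn_ord valK.
  have P0 : P != 0.
    apply: contra ne_e => /eqP P0; apply/eqP/ffunP => j.
    by have := P_j j; rewrite P0 coef0; case: (e j) (e' j) => [] [].
  have le1 j : `|P`_j| <= 1.
    have [lt_jn|le_nj] := ltnP j n; last by rewrite coef_poly ltnNge le_nj.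
    by rewrite (P_j (Ordinal lt_jn)); case: (e _) (e' _) => [] [].
  have lc2 : lead_coef P * lead_coef P = 1.
    have : lead_coef P != 0 by rewrite lead_coef_eq0.
    have := le1 (size P).-1; rewrite -/(lead_coef P).
    move: (lead_coef P : int) => c; nia.
  have annP : act (P \Po 'X^k) x = 0.
    rewrite act_comp_Xn (big_ord_widen n (fun i => iter (k * i) phi x *~ P`_i))
      ?size_poly //.
    rewrite big_mkcond /=.
    transitivity (f e - f e'); last by rewrite eq_f subrr.
    rewrite /f -sumrB; apply: eq_bigr => j _; rewrite -mulrzBr -P_j.
    by case: ltnP => // le_Pj; rewrite nth_default // mulr0z.
  have := no_rel (lead_coef P *: P);
    rewrite monicE lead_coefZ lc2 => /(_ (eqxx _)).
  rewrite comp_polyZ actZ annP mul0rz eqxx; apply => i.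
  by rewrite coefZ normrM -[1]mulr1 ler_pM ?le1.
have /injectiveP uniq_f := inj_f.
have <- : size (codom f) = (2 ^ n)%N by rewrite size_codom card_ffun card_bool
  card_ord.
by apply: uniq_leq_size => // _ /codomP[e ->].
Qed.

End PolynomialAction.

(** * Polynomial growth of frakQ *)

Section PolynomialGrowth.
Variables (G : zmodType) (phi : {additive G -> G}).

Lemma frakQ_common_annihilator (F : {fset G}) : (forall x, x \in F -> frakQ phi
  x) ->
  exists2 s, descending s & forall x, x \in F -> act phi (cycprod s) x = 0.
Proof.
move=> QF; have : forall x, x \in enum_fset F -> frakQ phi x by [].
suff : forall r : seq G, (forall x, x \in r -> frakQ phi x) ->
    exists2 s, descending s & forall x, x \in r -> act phi (cycprod s) x = 0.
  by move=> H /H[s desc_s ann_s]; exists s.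
elim=> [_|x r IHr Qr]; first by exists [::].
have [|t desc_t ann_t] := IHr; first by move=> y r_y; apply: Qr;
  rewrite inE r_y orbT.
have [s desc_s ann_s] := (frakQP phi x).1 (Qr x (mem_head _ _)).
exists (s ++ t); first by rewrite [descending _]all_cat; apply/andP; split.
move=> y; rewrite inE cycprod_cat => /predU1P[->|r_y].
  by rewrite mulrC actM ann_s raddf0.
by rewrite actM ann_t // raddf0.
Qed.

(** Grouping the terms of an element of the trajectory by the element x of F
that they come from, the times at which x is used are the exponents in p x. *)
Lemma trajectory_polys (F : {fset G}) n t : t \in trajectory phi F n ->
  exists p : F -> {poly int},
    [/\ forall x, (size (p x) <= n)%N, forall x, l1norm (p x) <= n%:R
      & t = \sum_(x : F) act phi (p x) (val x)].
Proof.
case/trajectoryP=> c Fc ->.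
exists (fun x => \poly_(i < n) (c i == val x)%:R); split => [x|x|].
- exact: size_poly.
- rewrite (l1normE (size_poly _ _)) -[n in n%:R]card_ord -sumr_const.
  apply: ler_sum => i _; rewrite coef_poly ltn_ord.
  by case: (c i == val x); rewrite ?normr1 ?normr0.
under [RHS]eq_bigr => x _.
  rewrite (actE _ _ (size_poly _ _)).
  under eq_bigr => i _ do rewrite coef_poly ltn_ord.
  over.
rewrite exchange_big /=; apply: eq_bigr => i _.
rewrite (bigD1 [` Fc i (ltn_ord i)]%fset) //= eqxx mulr1z big1 ?addr0 // => x
  ne_x.
case: eqP => [ci|_]; last by rewrite mulr0z.
by case/eqP: ne_x; apply: val_inj; rewrite /= ci.
Qed.

(** An element of A is determined by #|F| * D integers between - M and M. *)
Lemma card_le_bounded_combinations (A F : {fset G}) (D M : nat) :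
    (forall t, t \in A -> exists r : F -> {poly int},
       [/\ forall x, (size (r x) <= D)%N, forall x i, `|(r x)`_i| <= M%:Z
         & t = \sum_(x : F) act phi (r x) (val x)]) ->
  (#|` A| <= M.*2.+1 ^ (#|{: F}| * D))%N.
Proof.
move=> repr; pose code := {ffun F * 'I_D -> 'I_(M.*2.+1)}.
pose decode (c : code) : G :=
  \sum_(x : F) \sum_(j < D) iter j phi (val x) *~ ((c (x, j))%:Z - M%:Z).
have <- : size (codom decode) = (M.*2.+1 ^ (#|{: F}| * D))%N.
  by rewrite size_codom card_ffun card_prod !card_ord.
apply: uniq_leq_size => [|t At]; first exact: fset_uniq.
have [r [size_r le_r ->]] := repr t At.
apply/codomP; exists [ffun u : F * 'I_D => inord (absz ((r u.1)`_u.2 + M%:Z))].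
apply: eq_bigr => x _; rewrite (actE _ _ (size_r x)); apply: eq_bigr => j _.
rewrite ffunE /=; congr (_ *~ _).
have := le_r x j; move: ((r x)`_j : int) => c le_c.
by rewrite inordK; lia.
Qed.

(** The polynomials p x of [trajectory_polys] may be replaced by their
remainders modulo a product that kills F. *)
Lemma poly_growth_frakQ (F : {fset G}) :
  (forall x, x \in F -> frakQ phi x) -> poly_growth_wrt phi F.
Proof.
case/frakQ_common_annihilator => s desc_s ann_s.
have [D [C C0 divs]] := l1norm_mod_cycprod desc_s.
pose M n := (absz C * n.+1 ^ (size s).+1)%N.
exists (((absz C).*2%:R *: ('X + 1) ^+ (size s).+1 + 1) ^+ (#|{: F}| * D))
  => n _.
have : (tau phi F n <= (M n).*2.+1 ^ (#|{: F}| * D))%N.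
  apply: card_le_bounded_combinations => t /trajectory_polys
    [p [size_p len_p ->]].
  have {}divs x := divs n (p x) (size_p x).
  have [q {divs}/choice[r divs]] := choice divs.
  exists r; split => [x|x i|].
  - by have [_ _ size_r _ _] := divs x.
  - have [_ _ _ _ len_r] := divs x.
    apply: le_trans (norm_coef_l1norm _ _) (le_trans len_r _).
    rewrite /M PoszM gez0_abs // expnSr PoszM mulrA.
    rewrite -[Posz (_ ^ _)]natz natrX.
    apply: ler_pM => //.
    + by rewrite mulr_ge0 // exprn_ge0.
    + exact: l1norm_ge0.
    + by rewrite (le_trans (len_p x)) // natz lez_nat.
  apply: eq_bigr => x _; have [def_p _ _ _ _] := divs x.
  by rewrite def_p actD actM ann_s ?raddf0 ?add0r //; exact: valP.
rewrite -lez_nat => le_tau; apply: (le_trans le_tau).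
rewrite horner_exp hornerD hornerZ horner_exp hornerD hornerX !hornerC.
rewrite -[Posz (_ ^ _)]natz natrX le_eqVlt; apply/orP; left; apply/eqP.
congr (_ ^+ _); rewrite -[n%:Z]natz natr1 -natrX -natrM.
rewrite [RHS]natr1 -doubleMl; congr _%:R.
Qed.

Lemma Qn_restr (H : inv_subgroup phi) n (y : inv_type H) :
  Qn (@restr _ _ H) n y <-> Qn phi n (val y).
Proof.
have val_iter k (z : inv_type H) : val (iter k (@restr _ _ H) z) = iter k phi
  (val z).
  by elim: k => //= k ->.
elim: n y => [|n IHn] y /=; first by split=> [->|y0] //; apply: val_inj.
by split=> -[k [m [lt_mk Qkm]]]; exists k, m; split => //;
  move: Qkm; rewrite IHn -!val_iter -raddfB.
Qed.

Lemma frakQ_restr (H : inv_subgroup phi) (y : inv_type H) :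
  frakQ (@restr _ _ H) y <-> frakQ phi (val y).
Proof. by split=> -[n _ /Qn_restr Qy]; exists n. Qed.

End PolynomialGrowth.

(** * Existence and values of the entropy *)

Section RealSequences.
Variable R : realType.

(** Fekete's lemma: the limit is the infimum l over n > 0. If u m / m is close
to l, then writing n = q m + r with r < m bounds u n by n (u m / m) plus a
constant independent of n. *)
Lemma fekete (u : nat -> R) :
    (forall n, 0 <= u n) -> (forall m n, u (m + n)%N <= u m + u n) ->
  cvgn (fun n => u n / n%:R).
Proof.
move=> u0 uD; pose E := [set u n.+1 / n.+1%:R | n in [set: nat]].
have E0 : E !=set0 by exists (u 1%N / 1), 0%N.
have lbE : has_lbound E.
  by exists 0 => _ [n _ <-]; rewrite divr_ge0.
apply/cvg_ex; exists (inf E); apply/cvgrPdist_le => /= e e0.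
have [_ [m _ <-] lt_m] : exists2 x, E x & x < inf E + e / 2.
  by apply: inf_adherent => //; rewrite divr_gt0.
have u_mul k l : u (k * l)%N <= k%:R * u l + u 0%N.
  elim: k => [|k IHk]; first by rewrite mul0n mul0r add0r.
  by rewrite mulSn (le_trans (uD _ _)) // -natr1; lra.
pose K := m.+1%:R * u 1%N + u 0%N + u 0%N.
have K0 : 0 <= K by rewrite !addr_ge0 ?mulr_ge0.
near=> n.
have n0 : 0 < n%:R :> R by rewrite ltr0n; near: n; exists 1%N.
have le_inf : inf E <= u n / n%:R.
  apply: ge_inf => //; exists n.-1 => //; rewrite prednK //.
  by rewrite -(ltr0n R).
rewrite ler0_norm ?subr_le0 // opprB lerBlDl.
have le_un : u n <= n%:R * (u m.+1 / m.+1%:R) + K.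
  rewrite {1}(divn_eq n m.+1) (le_trans (uD _ _)) //.
  have le_q : u (n %/ m.+1 * m.+1)%N <= n%:R * (u m.+1 / m.+1%:R) + u 0%N.
    rewrite (le_trans (u_mul _ _)) // lerD2r mulrA ler_pdivlMr // mulrAC.
    by rewrite ler_wpM2r // -natrM ler_nat leq_trunc_div.
  have le_r : u (n %% m.+1)%N <= m.+1%:R * u 1%N + u 0%N.
    rewrite -[X in u X]muln1 (le_trans (u_mul _ _)) // lerD2r.
    by rewrite ler_wpM2r // ler_nat ltnW // ltn_mod.
  rewrite (le_trans (lerD le_q le_r)) // /K -!addrA lerD2l addrCA. exact: lexx.
rewrite ler_pdivrMr // (le_trans le_un) //.
have le_K : K <= e / 2 * n%:R.
  rewrite -ler_pdivrMl ?divr_gt0 //; near: n; exact: nbhs_infty_ger.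
have le_main : n%:R * (u m.+1 / m.+1%:R) <= n%:R * (inf E + e / 2).
  by rewrite ler_wpM2l // ltW.
have -> : (inf E + e) * n%:R = n%:R * (inf E + e / 2) + e / 2 * n%:R by lra.
exact: lerD.
Unshelve. all: by end_near.
Qed.

Lemma cvg0_le_inv_sqrt (v : nat -> R) (K : R) :
    (forall n, 0 <= v n) -> (forall n, (0 < n)%N -> v n <= K / Num.sqrt n%:R) ->
  (v n @[n --> \oo] --> (0 : R)).
Proof.
move=> v0 v_le; apply/cvgrPdist_le => /= e e0; near=> n.
have n0 : (0 < n)%N by near: n; exists 1%N.
rewrite sub0r normrN ger0_norm // (le_trans (v_le _ n0)) //.
rewrite ler_pdivrMr ?sqrtr_gt0 ?ltr0n // -ler_pdivrMl //.
rewrite (le_trans (ler_norm _)) // -sqrtr_sqr ler_sqrt ?ler0n //.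
near: n; exact: nbhs_infty_ger.
Unshelve. all: by end_near.
Qed.

(** A weak bound, which suffices for ln n / n to tend to 0. *)
Lemma ln_le_sqrt (x : R) : 0 < x -> ln x <= 2 * Num.sqrt x.
Proof.
move=> x0; rewrite -{1}[x]sqr_sqrtr ?(ltW x0) // lnXn ?sqrtr_gt0 //.
by rewrite -[ln _ *+ 2]mulr_natl ler_wpM2l ?(ltW (ln_sublinear _)) ?sqrtr_gt0.
Qed.

End RealSequences.

Section Entropy.
Variables (R : realType) (G : zmodType) (phi : {additive G -> G}).

Lemma ln_tau_ge0 (F : {fset G}) n : F != fset0 -> 0 <= ln (tau phi F n)%:R :> R.
Proof. by move=> F0; rewrite ln_ge0 // ler1n tau_gt0. Qed.

Lemma cvg_entropy_wrt (F : {fset G}) : F != fset0 ->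
  cvgn (fun n => ln (tau phi F n)%:R / n%:R : R).
Proof.
move=> F0; apply: (@fekete R (fun n => ln (tau phi F n)%:R)) => [n|m n].
  exact: ln_tau_ge0.
have tau_pos k : 0 < (tau phi F k)%:R :> R by rewrite ltr0n tau_gt0.
rewrite -lnM ?posrE // ler_ln ?posrE ?mulr_gt0 // -natrM ler_nat.
exact: tau_submultiplicative.
Qed.

(** For n > 0, P(n) <= A n^d with d = size P, so ln (tau n) / n is at most
(ln A + 2 d) / sqrt n. *)
Lemma entropy_wrt_poly_growth (F : {fset G}) : F != fset0 ->
  poly_growth_wrt phi F -> entropy_wrt phi R F = 0.
Proof.
move=> F0 [P leP]; apply/cvg_lim => //.
pose A : int := l1norm P + 1; pose d := size P.
have A1 : 1 <= A by rewrite lerDr l1norm_ge0.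
have A0 : 0 < A%:~R :> R by rewrite ltr0z (lt_le_trans ltr01).
have tau_pos k : 0 < (tau phi F k)%:R :> R by rewrite ltr0n tau_gt0.
apply: (@cvg0_le_inv_sqrt R _ (ln (A%:~R) + 2 * d%:R)) => [n|n n0].
  by rewrite divr_ge0 // ln_tau_ge0.
have n1 : 1 <= n%:R :> R by rewrite ler1n.
have nR0 : 0 < n%:R :> R by rewrite ltr0n.
have tau_le : (tau phi F n)%:Z <= A * n%:Z ^+ d.
  rewrite (le_trans (leP n n0)) // horner_coef (le_trans (ler_norm _)) //.
  rewrite (le_trans (ler_norm_sum _ _ _)) //.
  apply: (@le_trans _ _ (l1norm P * n%:Z ^+ d)); last first.
    by rewrite ler_wpM2r ?exprn_ge0 // lerDl.
  rewrite /l1norm mulr_suml; apply: ler_sum => i _.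
  rewrite normrM normrX ler_wpM2l // ger0_norm // ler_weXn2l ?lez_nat //.
  exact: ltnW.
have ln_tau : ln (tau phi F n)%:R <= ln (A%:~R) + d%:R * ln n%:R :> R.
  rewrite mulr_natl -lnXn // -lnM ?posrE ?exprn_gt0 //.
  rewrite ler_ln ?posrE ?mulr_gt0 ?exprn_gt0 //.
  by move: tau_le; rewrite -(ler_int R) rmorphM rmorphXn.
have s1 : 1 <= Num.sqrt n%:R :> R by rewrite -{1}sqrtr1 ler_sqrt.
have s0 : 0 < Num.sqrt n%:R :> R by exact: lt_le_trans s1.
rewrite ler_pdivrMr // -{2}[n%:R]sqr_sqrtr ?ler0n // expr2 mulrA divfK ?gt_eqF
  //.
rewrite (le_trans ln_tau) // mulrDl lerD //.
  by rewrite ler_peMr // ln_ge0 // -[1]/(1%:~R) ler_int.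
by rewrite (mulrC 2) -mulrA ler_wpM2l // ln_le_sqrt.
Qed.

Lemma entropy_poly_growth : poly_growth phi -> entropy phi R = 0%E.
Proof.
move=> pg; rewrite /entropy (_ : [set _ | _ in _] = [set 0%E]) ?ereal_sup1 //.
apply/seteqP; split => [_ [F F0 <-]|_ ->] /=.
  by rewrite entropy_wrt_poly_growth //; exact: pg.
exists [fset 0%R]%fset; first by apply/fset0Pn; exists 0; rewrite fset11.
by rewrite entropy_wrt_poly_growth //; [|apply: pg]; apply/fset0Pn; exists 0;
  rewrite fset11.
Qed.

(** Growth along multiples of k controls all n, because
2^n <= tau (k n) <= (tau n)^k. *)
Lemma entropy_wrt_exponential (F : {fset G}) k : F != fset0 -> (0 < k)%N ->
  (forall n, (2 ^ n <= tau phi F (k * n))%N) -> 0 < entropy_wrt phi R F.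
Proof.
move=> F0 k0 tau_ge.
have ln2 : 0 < ln 2 :> R by rewrite ln_gt0 // ltr1n.
apply: (@lt_le_trans _ _ (ln 2 / k%:R)); first by rewrite divr_gt0 // ltr0n.
apply: limr_ge; first exact: cvg_entropy_wrt.
near=> n; have n0 : (0 < n)%N by near: n; exists 1%N.
have tau_pos j : 0 < (tau phi F j)%:R :> R by rewrite ltr0n tau_gt0.
rewrite ler_pdivrMr ?ltr0n // mulrAC ler_pdivlMr ?ltr0n //.
rewrite !mulr_natr -!lnXn // ler_ln ?posrE ?exprn_gt0 // -!natrX ler_nat.
by rewrite (leq_trans (tau_ge n)) // tau_mul_leq.
Unshelve. all: by end_near.
Qed.

(** If no small monic polynomial in X^k killed x, the set {0, x} would have
positive entropy. *)
Lemma frakQ_of_entropy0 x : entropy phi R = 0%E -> frakQ phi x.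
Proof.
move=> h0; apply/frakQP.
apply: (@ideal_cycprod (fun p => act phi p x = 0)) => [p q|p q|k k0].
- by rewrite actD => -> ->; rewrite addr0.
- by rewrite actM => ->; rewrite raddf0.
apply: contrapT => no_rel.
have F0 : [fset 0%R; x]%fset != fset0 by apply/fset0Pn; exists 0;
  rewrite !inE eqxx.
have : 0 < entropy_wrt phi R [fset 0%R; x]%fset.
  apply: (entropy_wrt_exponential F0 k0) => n;
    apply: exponential_tau => // g mon_g le1.
  by apply/negP => /eqP ann_g; apply: no_rel; exists g.
have : ((entropy_wrt phi R [fset 0%R; x]%fset)%:E <= entropy phi R)%E.
  by apply: ereal_sup_ubound; exists [fset 0%R; x]%fset.
by rewrite h0 lee_fin leNgt => /negP.
Qed.

End Entropy.

(** * The three subgroups coincide *)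

Theorem mainTheorem1 (R : realType) (G : zmodType) (phi : {additive G -> G}) :
  is_Pol phi (frakQ phi) /\ is_Pinsker phi R (frakQ phi).
Proof.
have pg : poly_growth (@restr _ _ (frakQ_subgroup phi)).
  move=> F F0; apply: poly_growth_frakQ => y _; apply/frakQ_restr.
  by have := valP y; rewrite /inv_pred in_setE.
have maxQ (K : inv_subgroup phi) :
    entropy (@restr _ _ K) R = 0%E -> inv_carrier K `<=` frakQ phi.
  move=> hK x Kx; have Kx' : inv_pred K x by rewrite /inv_pred in_setE.
  by have /frakQ_restr := frakQ_of_entropy0 (exist _ x Kx' : inv_type K) hK.
split; exists (frakQ_subgroup phi); split => //.
  by move=> K pgK; apply: maxQ; exact: entropy_poly_growth.
exact: entropy_poly_growth.
Qed.
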